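(* Let $R=F_1^{m_1}\oplus\cdots\oplus F_k^{m_k}$ be the decomposition of a finite semi-simple commutative ring $R$ into finite fields, where $F_1,\ldots,F_k$ are distinct (pairwise non-isomorphic) finite fields and $m_1,\ldots,m_k\geq1$. Then \[\mathrm{Aut}(\mathfrak{J}_R)\cong\big(\mathrm{Aut}(\mathfrak{J}_{F_1})\wr S_{m_1}\big)\times\cdots\times\big(\mathrm{Aut}(\mathfrak{J}_{F_k})\wr S_{m_k}\big),\] where \[\mathrm{Aut}(\mathfrak{J}_{F_i})\cong\left(\mathbb{Z}_2\wr S_{\frac{|F_i|-2-\varepsilon_{F_i}}{2}}\right)\times\mathbb{Z}_{\varepsilon_{F_i}+1}\] if $|F_i|\geq4$, $\mathrm{Aut}(\mathfrak{J}_{\mathbb{Z}_3})\cong\mathbb{Z}_2$, and $\mathrm{Aut}(\mathfrak{J}_{\mathbb{Z}_2})$ is the trivial group.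
   Context: For a commutative ring $R$ with non-zero identity, $J(R)$ denotes its Jacobson radical and $U(R)$ its group of units. The Jacobson graph $\mathfrak{J}_R$ is the simple graph with vertex set $R\setminus J(R)$ in which two distinct vertices $x,y$ are adjacent if and only if $1-xy\notin U(R)$. $\mathrm{Aut}(\mathfrak{J}_R)$ is its group of graph automorphisms. A ring is semi-simple if $J(R)=0$. For a finite field $F$, $\varepsilon_F=0$ if $|F|$ is even and $\varepsilon_F=1$ if $|F|$ is odd. $\mathbb{Z}_n$ is the cyclic group of order $n$ ($\mathbb{Z}_1$ trivial), and $\mathbb{Z}_2,\mathbb{Z}_3$ also denote the fields of orders $2$ and $3$ when used as rings. $S_n$ is the symmetric group of degree $n$, and $G\wr S_n=G^n\rtimes S_n$ is the wreath product with $S_n$ permuting the $n$ coordinates. *)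

(* Defs.v *)
From mathcomp Require Import all_boot all_order all_algebra all_fingroup all_solvable all_field.

Set Implicit Arguments.
Unset Strict Implicit.
Unset Printing Implicit Defensive.

Import GroupScope GRing.Theory.
Local Open Scope ring_scope.

Section JacobsonGraph.
Variable R : finComUnitRingType.

(* Boolean form, on finite sets, of ring_quotient.idealr_closed. *)
Definition proper_idealb (I : {set R}) : bool :=
  [&& 0 \in I, 1 \notin I &
      [forall a, forall u in I, forall v in I, a * u + v \in I]].

Lemma proper_idealP (I : {set R}) : reflect (idealr_closed I) (proper_idealb I).
Proof.
apply: (iffP and3P) => [] [I0 I1 Icl]; split=> //.
  by move=> a u v Iu Iv; have /forall_inP/(_ u Iu)/forall_inP/(_ v Iv) := forallP Icl a.
by apply/forallP=> a; apply/forall_inP=> u Iu; apply/forall_inP=> v Iv; apply: Icl.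
Qed.

Definition maximal_ideal (M : {set R}) : bool := maxset proper_idealb M.

Definition jacobson_radical : {set R} := \bigcap_(M | maximal_ideal M) M.

Definition semisimple : Prop := jacobson_radical = [set 0].

Definition jacobson_vertex : finType := {x : R | x \notin jacobson_radical}.

Definition jacobson_adj : rel jacobson_vertex :=
  fun x y => (x != y) && (1 - val x * val y \isn't a GRing.unit).

Lemma jacobson_adj_irr : irreflexive jacobson_adj.
Proof. by move=> x; rewrite /jacobson_adj eqxx. Qed.

Lemma jacobson_adj_sym : symmetric jacobson_adj.
Proof. by move=> x y; rewrite /jacobson_adj eq_sym mulrC. Qed.

End JacobsonGraph.

Section GraphAutomorphisms.
Variables (V : finType) (e : rel V).

Definition graph_aut : {set {perm V}} :=
  [set s : {perm V} | [forall x, forall y, e (s x) (s y) == e x y]].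

Lemma graph_autP (s : {perm V}) :
  reflect (forall x y, e (s x) (s y) = e x y) (s \in graph_aut).
Proof.
rewrite inE; apply: (iffP forallP) => [se x y | se x].
  by apply/eqP; apply: (forallP (se x)).
by apply/forallP=> y; rewrite se.
Qed.

Lemma graph_aut_group_set : group_set graph_aut.
Proof.
apply/group_setP; split=> [|s t /graph_autP se /graph_autP te].
  by apply/graph_autP=> x y; rewrite !perm1.
by apply/graph_autP=> x y; rewrite !permM te se.
Qed.

Canonical graph_aut_group := Group graph_aut_group_set.

End GraphAutomorphisms.

Definition jacobson_aut (R : finComUnitRingType) : {group {perm jacobson_vertex R}} :=
  graph_aut_group (@jacobson_adj R).

Section Wreath.
Variables (gT : finGroupType) (n : nat).

Definition wreath_base : finGroupType := {dffun forall i : 'I_n, gT}.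

(* The inverse makes this a right action, since (s * t) i = t (s i). *)
Definition coord_perm (f : wreath_base) (s : 'S_n) : wreath_base :=
  [ffun i => f (s^-1%g i)].

Lemma coord_perm_is_action : is_action [set: 'S_n] coord_perm.
Proof.
split=> [s f g /ffunP fg | f s t _ _]; apply/ffunP=> i.
  by have := fg (s i); rewrite !ffunE permK.
by rewrite !ffunE invMg permM.
Qed.

Canonical coord_perm_action := Action coord_perm_is_action.

Lemma coord_perm_is_groupAction :
  is_groupAction [set: wreath_base] coord_perm_action.
Proof.
move=> s _; rewrite inE; apply/andP; split.
  by apply/subsetP=> f _; rewrite inE.
by apply/morphicP=> f g _ _; rewrite !actpermE /=; apply/ffunP=> i; rewrite !ffunE.
Qed.

Definition coord_perm_groupAction := GroupAction coord_perm_is_groupAction.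

Definition wreath : finGroupType := sdprod_by coord_perm_groupAction.

End Wreath.

(* R is isomorphic, as a ring, to the direct sum of m i copies of F i, for all
   i: the phi i j are the coordinate projections, and their joint bijectivity
   is that of the induced ring morphism into the product. *)
Definition direct_sum_decomposition (R : finComUnitRingType) (k : nat)
    (F : 'I_k -> finFieldType) (m : 'I_k -> nat) : Prop :=
  exists phi : forall i : 'I_k, 'I_(m i) -> {rmorphism R -> F i},
    bijective (fun x : R =>
      [ffun i => [ffun j => phi i j x]]
        : {dffun forall i : 'I_k, {ffun 'I_(m i) -> F i}}).

Definition field_isomorphic (E F : finFieldType) : Prop :=
  exists f : {rmorphism E -> F}, bijective f.

Definition parity (F : finFieldType) : nat := if odd #|F| then 1 else 0.

(* Main.v *)
(* Call a vertex x of R = prod_t K_t looped when some x_t^2 = 1, and write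
   meet x y when some x_t y_t = 1. An automorphism of the (loopless) Jacobson
   graph preserves loopedness, hence meet; and x is obtained from y by replacing
   coordinates by zeros exactly when everything meeting x meets y. So it permutes
   the atoms, the vectors with a single nonzero coordinate, and it respects the
   partition of the atoms by coordinate, since two distinct atoms lie over the
   same coordinate iff they have no common upper bound. The coordinates are
   thus permuted, only among fields of equal cardinality, which are isomorphic;
   and an automorphism is determined by its action on the atoms. For a field E
   the graph is the matching of each x with x^-1, so its automorphism group is
   the centraliser of inversion in Sym (E^* ), where inversion has the fixed
   points 1 and -1. *)

From HB Require Import structures.
Require Import Defs.
From mathcomp Require Import all_boot all_order all_algebra all_fingroup all_solvable all_field.
Import GroupScope GRing.Theory.

Set Implicit Arguments.
Unset Strict Implicit.
Unset Printing Implicit Defensive.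

(** * Finite fields of the same cardinality *)

Section FiniteFieldUniqueness.
Local Open Scope ring_scope.

Lemma finField_primitive_elt (E : finFieldType) :
  exists z : E, forall x, x != 0 -> exists k, x = z ^+ k.
Proof.
have /cyclicP[u Eu] := field_unit_group_cyclic [set: {unit E}]%G.
exists (val u) => x x0.
have Ux : x \is a GRing.unit by rewrite unitfE.
have : FinRing.unit E Ux \in <[u]>%g by rewrite -Eu inE.
by case/cycleP=> k /(congr1 val)/= ->; exists k; rewrite -FinRing.val_unitX.
Qed.

Variables K E F : finFieldType.
Variables (iE : {rmorphism K -> E}) (iF : {rmorphism K -> F}).
Hypothesis cardEF : #|E| = #|F|.

(** Every element of [E] is a root; over [F], since [#|E| = #|F|], it is the product of all
    ['X - x%:P]. *)
Let genK := ('X^#|E| - 'X : {poly K}).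

Let genK_neq0 : genK != 0.
Proof.
rewrite -size_poly_gt0 size_polyDl ?size_polyXn //.
by rewrite size_polyN size_polyX ltnS finNzRing_gt1.
Qed.

(* A root of the minimal polynomial of z exists in F because that polynomial
   divides X^q - X, which splits over F. *)
Lemma finField_transfer_root (z : E) :
  exists w : F, forall P : {poly K},
    root (map_poly iE P) z -> root (map_poly iF P) w.
Proof.
(* Coefficient tuples make it decidable whether [z] has an annihilator of size at most [n]; at the
   least such [n] the witness [M] is a minimal polynomial of [z]. *)
pose ann n := [exists P : n.-tuple K, 
  (Poly P != 0) && root (map_poly iE (Poly P)) z].
have annP (P : {poly K}) : P != 0 -> root (map_poly iE P) z -> ann (size P).
  by move=> P0 Pz; apply/existsP; exists (in_tuple P); rewrite polyseqK P0.
have gen_z : root (map_poly iE genK) z.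
  by rewrite /genK rmorphB/= map_polyXn map_polyX rootE !hornerE expf_card subrr.
case: (ex_minnP (ex_intro ann _ (annP _ genK_neq0 gen_z))) => n.
case/existsP=> s /andP[]; set M := Poly s => M0 Mz minM.
have divM P : root (map_poly iE P) z -> M %| P.
  move=> Pz; rewrite /dvdp; apply/contraT => R0.
  have := minM _ (annP _ R0 _); rewrite leqNgt => /(_ _)/negP[].
    have := Pz; rewrite {1}(divp_eq P M) rmorphD rmorphM !rootE !hornerE/=.
    by rewrite (eqP Mz) mulr0 add0r.
  apply: leq_trans (ltn_modpN0 P M0) _.
  by apply: leq_trans (size_Poly _) _; rewrite size_tuple.
have gtM : (1 < size (map_poly iF M))%N.
  rewrite size_map_poly ltnNge; apply/negP=> /size1_polyC EM.
  move: Mz M0; rewrite EM map_polyC rootE hornerC fmorph_eq0 polyC_eq0.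
  by move=> ->.
have : map_poly iF M %| \prod_x ('X - x%:P).
  rewrite -finField_genPoly -cardEF -(map_polyXn iF) -(map_polyX iF) -rmorphB.
  by rewrite dvdp_map divM.
(* Up to a unit the image of [M] is a subproduct of linear factors, nonempty because [M] is not
   constant. *)
case/dvdp_prod_XsubC=> m; case: (mask _ _) => [|w r] eqM.
  by have := eqp_size eqM; rewrite big_nil size_poly1 => sz1; rewrite sz1 in gtM.
have Mw : root (map_poly iF M) w.
  by rewrite (eqp_root eqM) big_cons rootM root_XsubC eqxx.
exists w => P /divM MP.
by rewrite -dvdp_XsubCl (dvdp_trans (y := map_poly iF M)) ?dvdp_XsubCl ?dvdp_map.
Qed.

(** Each element of [E] is [P(z)] for some [P] over [K], and is sent to [P(w)]. Relations of [z]
    hold for [w], so the choice of [P] does not matter; field morphisms are injective, and equal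
    cardinality gives bijectivity. *)
Lemma same_card_field_isomorphic : field_isomorphic E F.
Proof.
have [z genz] := finField_primitive_elt E.
have [w zw] := finField_transfer_root z.
have polyz x : exists P : {poly K}, (map_poly iE P).[z] == x.
  have [->|/genz[k ->]] := eqVneq x 0.
    by exists 0; rewrite rmorph0 horner0.
  by exists 'X^k; rewrite map_polyXn hornerXn.
pose P x := xchoose (polyz x); have Pz x : (map_poly iE (P x)).[z] = x.
  exact/eqP/(xchooseP (polyz x)).
pose f x := (map_poly iF (P x)).[w].
have fE x Q : (map_poly iE Q).[z] = x -> f x = (map_poly iF Q).[w].
  move=> Qz; apply/eqP; rewrite -subr_eq0 -hornerN -hornerD -rmorphB.
  by apply/zw; rewrite rmorphB rootE !hornerE/= Pz Qz subrr.
have fB : {morph f : x y / x - y}.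
  move=> x y; rewrite (fE _ (P x - P y)) ?rmorphB ?hornerE//=.
  by rewrite !Pz.
have fM : monoid_morphism f.
  split=> [|x y]; first by rewrite (fE _ 1) ?rmorph1 ?hornerC.
  by rewrite (fE _ (P x * P y)) ?rmorphM ?hornerM // !Pz.
pose f_add := GRing.isZmodMorphism.Build _ _ f fB.
pose f_mul := GRing.isMonoidMorphism.Build _ _ f fM.
pose fR : {rmorphism E -> F} := HB.pack f f_add f_mul.
exists fR; apply: inj_card_bij; first exact: fmorph_inj.
by rewrite cardEF.
Qed.

End FiniteFieldUniqueness.

(** Equal cardinality forces equal characteristic [p], and ['F_p] embeds in both fields. *)
Lemma finField_card_isomorphic (E F : finFieldType) :
  #|E| = #|F| -> field_isomorphic E F.
Proof.
move=> cardEF; have [p p_pr pE] := finPcharP E.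
have pF : p \in [pchar F]%R.
  apply: card_finPcharP p_pr; rewrite -cardEF.
  exact: (card_pprimeChar pE).
pose iE : {rmorphism 'F_p -> pPrimeCharType pE} := GRing.in_alg _.
pose iF : {rmorphism 'F_p -> pPrimeCharType pF} := GRing.in_alg _.
exact: (@same_card_field_isomorphic 'F_p E F iE iF).
Qed.

(** * The centraliser of an involution *)

Lemma wreath_eq (gT : finGroupType) n (u v : wreath gT n) :
  u.1 = v.1 -> u.2 = v.2 -> u = v.
Proof.
by case: u v => [[s f] sP] [[t g] tP] /= E1 E2; apply: val_inj; rewrite /= E1 E2.
Qed.

Section InvolutionCentraliser.
Variables (X : finType) (sg : X -> X).
Hypothesis sgK : involutive sg.

Definition fix_set := [set x | sg x == x].

Definition perm_centraliser : {set {perm X}} :=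
  [set p : {perm X} | [forall x, p (sg x) == sg (p x)]].

Lemma perm_centraliserP (p : {perm X}) :
  reflect (forall x, p (sg x) = sg (p x)) (p \in perm_centraliser).
Proof. by rewrite inE; apply: (iffP forallP) => h x; apply/eqP. Qed.

Lemma perm_centraliser_group_set : group_set perm_centraliser.
Proof.
apply/group_setP; split=> [|p q /perm_centraliserP cp /perm_centraliserP cq].
  by apply/perm_centraliserP=> x; rewrite !perm1.
by apply/perm_centraliserP=> x; rewrite !permM cp cq.
Qed.
Canonical perm_centraliser_group := Group perm_centraliser_group_set.

Lemma Z2_case (b : 'Z_2) : b = 0%R \/ b = 1%R.
Proof. by case: b => [[|[|//]] ?]; [left | right]; apply: val_inj. Qed.

Section Coordinates.
(** The 2-cycles of [sg] are numbered by ['I_n]; cycle [j] consists of [d (j, 0)] and [d (j, 1)]. *)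
Variables (n : nat) (d : 'I_n * 'Z_2 -> X).
Hypotheses (d_inj : injective d).
Hypothesis sg_d : forall j b, sg (d (j, b)) = d (j, b + 1)%R.
Hypothesis d_onto : forall x, x \notin fix_set -> exists jb, x = d jb.

Let W := wreath 'Z_2 n.

Lemma d_nonfix jb : d jb \notin fix_set.
Proof.
by case: jb => j b; rewrite inE sg_d (inj_eq d_inj) xpair_eqE eqxx; case: (Z2_case b) => ->.
Qed.

(** The shift of the bit is read at the target cycle [u.1 j], which is what makes this compatible
    with the product of [wreath]. *)
Definition wreath_fun (u : W) (x : X) : X :=
  if [pick jb | d jb == x] is Some (j, b) then
    d (u.1 j, b + u.2 (u.1 j))%R else x.

Lemma wreath_fun_d (u : W) j b :
  wreath_fun u (d (j, b)) = d (u.1 j, b + u.2 (u.1 j))%R.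
Proof.
rewrite /wreath_fun; case: pickP => [[j' b'] /eqP/d_inj[-> ->] //|/(_ (j, b))].
by rewrite eqxx.
Qed.

Lemma wreath_fun_fix (u : W) x : x \in fix_set -> wreath_fun u x = x.
Proof.
move=> fx; rewrite /wreath_fun; case: pickP => // jb /eqP E.
by have := d_nonfix jb; rewrite E fx.
Qed.

Lemma wreath_funM u v x : wreath_fun (u * v) x = wreath_fun v (wreath_fun u x).
Proof.
have [fx|/d_onto[[j b] ->]] := boolP (x \in fix_set).
  by rewrite !wreath_fun_fix.
rewrite !wreath_fun_d /= permM !ffunE permK.
by congr (d (_, _)); rewrite addrA.
Qed.

Lemma wreath_fun1 x : wreath_fun 1 x = x.
Proof.
have [fx|/d_onto[[j b] ->]] := boolP (x \in fix_set).
  by rewrite !wreath_fun_fix.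
by rewrite wreath_fun_d /= perm1 ffunE addr0.
Qed.

Lemma wreath_fun_inj u : injective (wreath_fun u).
Proof.
by apply: (can_inj (g := wreath_fun u^-1)) => x; rewrite -wreath_funM mulgV wreath_fun1.
Qed.

Definition wreath_perm u := perm (@wreath_fun_inj u).

Lemma wreath_permM : {in setT &, {morph wreath_perm : u v / u * v}}.
Proof.
by move=> u v _ _; apply/permP=> x; rewrite permM !permE wreath_funM.
Qed.
Canonical wreath_perm_morphism := Morphism wreath_permM.

Lemma injm_wreath_perm : 'injm wreath_perm.
Proof.
apply/subsetP=> u /morphpreP[_ /set1P/permP u1]; apply/set1P.
have Eu j : u.1 j = j /\ u.2 (u.1 j) = 0%R.
  by have := u1 (d (j, 0%R)); rewrite permE wreath_fun_d perm1 add0r => /d_inj[].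
apply: wreath_eq => /=.
  by apply/permP=> j; rewrite perm1; have [] := Eu j.
by apply/ffunP=> j; rewrite ffunE; have [E1 E2] := Eu j; rewrite -E1 E2.
Qed.

Lemma wreath_fun_cent u x : wreath_fun u (sg x) = sg (wreath_fun u x).
Proof.
have [fx|/d_onto[[j b] ->]] := boolP (x \in fix_set).
  have Ex : sg x = x by apply/eqP; rewrite inE in fx.
  by rewrite Ex !wreath_fun_fix.
by rewrite sg_d !wreath_fun_d sg_d addrAC.
Qed.

(** On cycle [j] the image [d (s j, c j)] of [d (j, 0)] determines [p], which commutes with [sg]. *)
Lemma wreath_perm_onto (p : {perm X}) : p \in perm_centraliser ->
  (forall x, x \in fix_set -> p x = x) -> exists u, p = wreath_perm u.
Proof.
move=> /perm_centraliserP cp pfix.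
have pd jb : {jb' | p (d jb) == d jb'}.
  apply: sigW; case: (d_onto (x := p (d jb))) => [|jb' ->]; last by exists jb'.
  apply/negP=> pf; have /perm_inj E := pfix _ pf.
  by have := d_nonfix jb; rewrite -E pf.
pose s j := (sval (pd (j, 0%R))).1; pose c j := (sval (pd (j, 0%R))).2.
have pd0 j : p (d (j, 0%R)) = d (s j, c j).
  by rewrite /s /c -surjective_pairing; case: (pd _) => jb /= /eqP.
have pdE j b : p (d (j, b)) = d (s j, b + c j)%R.
  case: (Z2_case b) => ->; first by rewrite add0r.
  by rewrite -[1%R]add0r -sg_d cp pd0 sg_d addrC add0r.
have s_inj : injective s.
  move=> i j Es; have := pdE i 0%R.
  (* If [s i = s j], then [d (i, 0)] and [d (j, c i - c j)] have the same image. *)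
  have -> : d (s i, 0 + c i)%R = p (d (j, c i - c j)%R).
    by rewrite pdE Es subrK add0r.
  by move=> /perm_inj/d_inj[].
have ux : (perm s_inj, [ffun j => c ((perm s_inj)^-1 j)] : wreath_base _ n)
   \in setX [set: 'S_n] [set: wreath_base 'Z_2 n] by rewrite !inE.
exists (SdPair (coord_perm_groupAction 'Z_2 n) ux).
apply/permP=> x; rewrite permE; have [fx|/d_onto[[j b] ->]] := boolP (x \in fix_set).
  by rewrite wreath_fun_fix // pfix.
by rewrite wreath_fun_d pdE /= ffunE permK permE.
Qed.

(** A permutation commuting with [sg] stabilises [fix_set], where it is arbitrary; dividing by its
    restriction there leaves a permutation of the 2-cycles alone. *)
Lemma perm_centraliser_dprod :
  (wreath_perm @* setT) \x perm.Sym fix_set = perm_centraliser.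
Proof.
have symP p : p \in perm.Sym fix_set -> forall x, x \notin fix_set -> p x = x.
  by rewrite inE => pS x; apply: out_perm pS.
have fixW u x : x \in fix_set -> wreath_perm u x = x.
  by rewrite permE; apply: wreath_fun_fix.
have nfixW u x : x \notin fix_set -> wreath_perm u x \notin fix_set.
  by case/d_onto=> [[j b] ->]; rewrite permE wreath_fun_d d_nonfix.
have symF p x : p \in perm.Sym fix_set -> (p x \in fix_set) = (x \in fix_set).
  by rewrite inE => pS; apply: perm_closed.
have fixE x : x \in fix_set -> sg x = x by rewrite inE => /eqP.
have symC : perm.Sym fix_set \subset perm_centraliser.
  apply/subsetP=> p pS; apply/perm_centraliserP=> x.
  have [fx|nfx] := boolP (x \in fix_set); first by rewrite !fixE ?symF.
  rewrite !(symP p) //; have [[j b] ->] := d_onto nfx.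
  by rewrite sg_d d_nonfix.
have WC : wreath_perm @* setT \subset perm_centraliser.
  apply/subsetP=> _ /morphimP[u _ _ ->]; apply/perm_centraliserP=> x.
  by rewrite !permE wreath_fun_cent.
rewrite dprodE.
- apply/eqP; rewrite eqEsubset mul_subG //=; apply/subsetP=> p pC.
  have pN : p \in 'N(fix_set | 'P).
    apply/astabsP=> x /=; rewrite !inE apermE.
    by rewrite -(perm_centraliserP _ pC) (inj_eq perm_inj).
  set q := restr_perm fix_set p.
  have qS : q \in perm.Sym fix_set by rewrite inE restr_perm_on.
  rewrite -[p](mulgKV q) mem_mulg //.
  have [||u ->] := @wreath_perm_onto (p * q^-1); last by rewrite mem_morphim ?inE.
    by rewrite groupM // groupV (subsetP symC).
  by move=> x fx; rewrite permM -(restr_permE pN fx) permK.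
- apply/centsP=> q qS _ /morphimP[u _ _ ->]; apply/permP=> x.
  rewrite !permM; have [fx|nfx] := boolP (x \in fix_set).
    by rewrite !fixW ?symF.
  by rewrite !(symP q) // nfixW.
apply/trivgP/subsetP=> _ /setIP[/morphimP[u _ _ ->] /symP qS]; apply/set1P/permP=> x.
rewrite perm1; have [fx|nfx] := boolP (x \in fix_set); last exact: qS.
exact: fixW.
Qed.

Lemma perm_centraliser_isog_coord (hT : finGroupType) (H : {group hT}) :
  perm.Sym fix_set \isog H ->
  perm_centraliser \isog setX [set: W] H.
Proof.
move=> isoH; apply: isog_dprod perm_centraliser_dprod (setX_dprod _ _) _ _.
  have isoW := sub_isog (subxx _) injm_wreath_perm.
  rewrite isog_sym in isoW; apply: isog_trans isoW _.
  by rewrite /= -morphim_pairg1 sub_isog ?injm_pairg1 ?subsetT.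
apply: isog_trans isoH _.
by rewrite /= -morphim_pair1g sub_isog ?injm_pair1g ?subsetT.
Qed.

End Coordinates.

Lemma perm_centraliser_isog n (hT : finGroupType) (H : {group hT}) :
  #|X| = #|fix_set| + n.*2 -> perm.Sym fix_set \isog H ->
  perm_centraliser \isog setX [set: wreath 'Z_2 n] H.
Proof.
(* [D] takes from each 2-cycle the point of smaller rank, so [D] and its image under [sg] partition
   the non-fixed points. *)
pose D := [set x | enum_rank x < enum_rank (sg x)].
have DE x : x \notin fix_set -> (sg x \in D) = (x \notin D).
  rewrite !inE sgK => nfx; rewrite -leqNgt [RHS]leq_eqVlt [X in X || _](_ : _ = false) //.
  by apply/eqP=> /val_inj/enum_rank_inj E; rewrite E eqxx in nfx.
have D_nfix x : x \in D -> x \notin fix_set.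
  by rewrite !inE => lt; apply/eqP=> E; rewrite E ltnn in lt.
have disj : [disjoint D & sg @: D].
  apply/pred0P=> x /=; apply/negP=> /andP[xD /imsetP[y yD E]].
  by move: xD; rewrite E DE ?D_nfix // yD.
have cover : ~: fix_set = D :|: sg @: D.
  apply/setP=> x; rewrite inE in_setU; apply/idP/orP=> [nfx|[/D_nfix //|/imsetP[y yD ->]]].
    have [xD|xD] := boolP (x \in D); [by left | right].
    by rewrite -[x]sgK imset_f // DE.
  by rewrite inE sgK eq_sym; have := D_nfix _ yD; rewrite inE.
move=> cardX; have En : n = #|D|.
  apply: double_inj; apply: (@addnI #|fix_set|); rewrite -cardX -(cardsC fix_set).
  rewrite cover cardsU (disjoint_setI0 disj) cards0 subn0.
  by rewrite card_imset ?addnn //; apply: inv_inj.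
pose d (jb : 'I_#|D| * 'Z_2) := if jb.2 == 0%R then enum_val jb.1 else sg (enum_val jb.1).
rewrite En; apply: (@perm_centraliser_isog_coord _ d).
- move=> [i a] [j b]; rewrite /d /=.
  have eN (u v : 'I_#|D|) : enum_val u <> sg (enum_val v).
    by move=> E; have := disjointFr disj (enum_valP u); rewrite E imset_f ?enum_valP.
  case: (Z2_case a) (Z2_case b) => -> [] -> //=.
  - by move/enum_val_inj ->.
  - by move/eN.
  - by move/esym/eN.
  - by move/(inv_inj sgK)/enum_val_inj ->.
- by move=> j b; rewrite /d /=; case: (Z2_case b) => -> //=; rewrite sgK.
move=> x nfx; have : x \in ~: fix_set by rewrite in_setC.
rewrite cover in_setU => /orP[xD|/imsetP[y yD ->]].
  by exists (enum_rank_in xD x, 0%R); rewrite /d /= enum_rankK_in.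
by exists (enum_rank_in yD y, 1%R); rewrite /d /= enum_rankK_in.
Qed.

End InvolutionCentraliser.

(** * The Jacobson graph of a field *)

Section FieldCase.
Local Open Scope ring_scope.
Variable E : finFieldType.

(** The zero ideal is maximal, since a nonzero element of an ideal of a field puts 1 in it. *)
Lemma field_semisimple : semisimple E.
Proof.
have ideal0 : proper_idealb [set 0 : E].
  apply/proper_idealP; split=> [||a u v]; rewrite !inE ?oner_eq0 //.
  by move=> /eqP-> /eqP->; rewrite mulr0 addr0.
have max0 : maximal_ideal [set 0 : E].
  apply/maxsetP; split=> // I /proper_idealP[I0 I1 Icl] _; apply/setP=> x.
  rewrite inE; apply/idP/eqP=> [Ix|-> //]; apply/eqP; apply: contraNT I1 => x0.
  by rewrite -[1]addr0 -(mulVf x0) Icl.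
apply/eqP; rewrite eqEsubset; apply/andP; split.
  by rewrite /jacobson_radical (bigcap_inf _ max0).
rewrite sub1set; apply/bigcapP=> I /maxsetP[/proper_idealP[I0 _ _] _] //.
Qed.

Lemma field_vertexE (x : E) : (x \notin jacobson_radical E) = (x != 0).
Proof. by rewrite field_semisimple inE. Qed.

Lemma field_vertex_neq0 (x : jacobson_vertex E) : val x != 0.
Proof. by rewrite -field_vertexE (valP x). Qed.

Lemma field_vertex_ex (r : E) : r != 0 -> exists a : jacobson_vertex E, val a = r.
Proof. by rewrite -field_vertexE => r0; exists (Sub r r0); rewrite SubK. Qed.

Lemma one_not_radical : (1 : E) \notin jacobson_radical E.
Proof. by rewrite field_vertexE oner_neq0. Qed.

Definition one_vertex : jacobson_vertex E := Sub 1 one_not_radical.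

Lemma card_field_vertex : #|{: jacobson_vertex E}| = #|E|.-1.
Proof.
by rewrite card_sig -(cardC1 (0 : E)); apply: eq_card => x; rewrite inE field_vertexE.
Qed.

Definition inv_vertex (x : jacobson_vertex E) : jacobson_vertex E :=
  insubd x (val x)^-1.

Lemma val_inv_vertex x : val (inv_vertex x) = (val x)^-1.
Proof. by rewrite val_insubd field_vertexE invr_eq0 field_vertex_neq0. Qed.

Lemma inv_vertexK : involutive inv_vertex.
Proof. by move=> x; apply: val_inj; rewrite !val_inv_vertex invrK. Qed.

Lemma inv_vertex_eq x y : (y == inv_vertex x) = (val x * val y == 1).
Proof.
rewrite -val_eqE val_inv_vertex; apply/eqP/eqP=> [->|E1].
  by rewrite divff ?field_vertex_neq0.
by rewrite -[val y]mul1r -(mulVf (field_vertex_neq0 x)) -mulrA E1 mulr1.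
Qed.

Lemma field_adjE (x y : jacobson_vertex E) :
  jacobson_adj x y = (x != y) && (y == inv_vertex x).
Proof. by rewrite /jacobson_adj unitfE negbK subr_eq0 inv_vertex_eq [1 == _]eq_sym. Qed.

(** The edges join each [x] to its inverse when the two differ, and self-inverse vertices are
    isolated. *)
Lemma jacobson_aut_fieldE :
  jacobson_aut E = perm_centraliser inv_vertex :> {set _}.
Proof.
apply/setP=> p; apply/graph_autP/perm_centraliserP=> [pE x | pC x y]; last first.
  by rewrite !field_adjE -pC !(inj_eq perm_inj).
have [fx|nfx] := eqVneq (inv_vertex x) x; last first.
  have : jacobson_adj x (inv_vertex x) by rewrite field_adjE eqxx eq_sym nfx.
  by rewrite -pE field_adjE => /andP[_ /eqP].
(* If [p x] were not self-inverse, the preimage [y] of its inverse would be a neighbour of the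
   isolated vertex [x]. *)
rewrite fx; apply/eqP/contraT=> npx.
have [y Ey] : exists y, p y = inv_vertex (p x).
  by exists (p^-1 (inv_vertex (p x)))%g; rewrite permKV.
have := pE x y; rewrite !field_adjE Ey eqxx npx fx /= eq_sym => /esym/andP[/eqP xy /eqP yx].
by rewrite yx in xy.
Qed.

(** [#|E|] is a positive power of the characteristic, so both sides say that the latter is not 2. *)
Lemma finField_odd : odd #|E| = (1 != -1 :> E).
Proof.
have [p p_pr pE] := finPcharP E; rewrite (card_pprimeChar pE).
have n_gt0 : (0 < logn p #|E|)%N.
  rewrite lt0n; apply/eqP=> n0; have := finNzRing_gt1 E.
  by rewrite (card_pprimeChar pE) n0.
rewrite oddX eqn0Ngt n_gt0 /= -subr_eq0 opprK -mulr2n.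
rewrite -(dvdn_pcharf pE) dvdn_prime2 //.
by apply/idP/idP; [apply: contraTneq => -> | apply: contraNT => /(prime_oddPn p_pr)/eqP].
Qed.

Lemma card_fix_inv_vertex : #|fix_set inv_vertex| = (parity E + 1)%N.
Proof.
have -> : #|fix_set inv_vertex| = #|[set 1; -1 : E]|.
  rewrite -(card_imset _ val_inj); congr #|pred_of_set _|; apply/setP=> x.
  rewrite !inE -sqrf_eq1; apply/imsetP/eqP=> [[y]|x2].
    by rewrite inE eq_sym inv_vertex_eq => /eqP <- ->.
  have x0 : x \notin jacobson_radical E.
    by rewrite field_vertexE; apply/eqP=> x0; move/eqP: x2; rewrite x0 expr0n eq_sym oner_eq0.
  by exists (Sub x x0); rewrite ?inE ?SubK // eq_sym inv_vertex_eq SubK -expr2 x2.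
by rewrite cards2 -finField_odd /parity; case: odd.
Qed.

(** Of the [#|E| - 1] vertices, [parity E + 1] are self-inverse and the others form inverse pairs.
    The symmetric group on the one or two self-inverse vertices is cyclic of order
    [parity E + 1]. *)
Lemma jacobson_aut_field_isog :
  jacobson_aut E \isog setX [set: wreath ('Z_2) ((#|E| - 2 - parity E) %/ 2)%N]
                         (Zp (parity E + 1)%N).
Proof.
rewrite jacobson_aut_fieldE; apply: perm_centraliser_isog.
- exact: inv_vertexK.
- rewrite card_field_vertex card_fix_inv_vertex.
  have par : parity E = odd #|E| by rewrite /parity; case: odd.
  have := finNzRing_gt1 E; rewrite -[#|E|]odd_double_half -par.
  case: (_./2) => [|h]; first by rewrite par addn0; case: odd.
  by rewrite subnAC addKn doubleS subn2 divn2 /= doubleK !addnS addSn addn0.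
have card2 (gT : finGroupType) (G : {group gT}) : #|G| = (parity E + 1)%N -> cyclic G.
  move=> cG; apply: (@dvdn_prime_cyclic _ _ 2) => //.
  by rewrite cG /parity; case: odd.
have cS : #|perm.Sym (fix_set inv_vertex)| = (parity E + 1)%N.
  by rewrite perm.card_Sym card_fix_inv_vertex /parity; case: odd.
have cZ : #|Zp (parity E + 1)%N| = (parity E + 1)%N.
  by rewrite card_Zp /parity; case: odd.
by rewrite isog_cyclic_card ?card2 //= cS cZ.
Qed.

End FieldCase.

(** Both vertices are self-inverse, so every permutation of them is an automorphism. *)
Lemma jacobson_aut_card3 (E : finFieldType) :
  #|E| = 3 -> jacobson_aut E \isog Zp 2.
Proof.
move=> E3; have par1 : parity E = 1%N by rewrite /parity E3.
have fixT : fix_set (@inv_vertex E) = setT.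
  apply/eqP; rewrite eqEcard subsetT cardsT card_field_vertex card_fix_inv_vertex.
  by rewrite par1 E3.
have autT : jacobson_aut E = perm.Sym (fix_set (@inv_vertex E)) :> {set _}.
  rewrite jacobson_aut_fieldE; apply/setP=> p; rewrite inE [RHS]inE fixT.
  have fixE x : inv_vertex x = x :> jacobson_vertex E.
    by have := in_setT x; rewrite -fixT inE => /eqP.
  have -> : perm_on setT p by apply/subsetP=> x; rewrite inE.
  apply/forallP=> x.
  by rewrite !fixE.
have cA : #|jacobson_aut E| = 2.
  by rewrite autT perm.card_Sym card_fix_inv_vertex par1.
have cZ : #|Zp 2| = 2 by rewrite card_Zp.
by rewrite isog_cyclic_card ?prime_cyclic ?cA ?cZ.
Qed.

Lemma jacobson_aut_card2 (E : finFieldType) :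
  #|E| = 2 -> jacobson_aut E = 1 :> {set _}.
Proof.
move=> E2; have V1 : #|{: jacobson_vertex E}| <= 1 by rewrite card_field_vertex E2.
apply/trivgP/subsetP=> p _; apply/set1P/permP=> x.
exact: (fintype_le1P V1).
Qed.

(** * Automorphisms of the Jacobson graph of a product of fields *)

Section Coordinates.
Local Open Scope ring_scope.
Variables (R : finComUnitRingType) (T : finType) (K : T -> finFieldType).
Variable phi : forall t, {rmorphism R -> K t}.
(** [mk] rebuilds an element of [R] from its coordinates; with [phi] it presents [R] as the product
    of the [K t]. *)
Variable mk : (forall t, K t) -> R.
Hypothesis R_semisimple : semisimple R.
Hypothesis mkE : forall c t, phi t (mk c) = c t.
Hypothesis phi_inj : forall x y, (forall t, phi t x = phi t y) -> x = y.

Local Notation V := (jacobson_vertex R).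
Implicit Types (x y z : V) (p : {perm V}) (t : T).

Definition vcoord x t : K t := phi t (val x).

Lemma vertexE (r : R) : (r \notin jacobson_radical R) = (r != 0).
Proof. by rewrite R_semisimple inE. Qed.

Lemma vcoord_inj x y : (forall t, vcoord x t = vcoord y t) -> x = y.
Proof. by move=> xy; apply: val_inj; apply: phi_inj. Qed.

Lemma vertex_coord_neq0 x : exists t, vcoord x t != 0.
Proof.
apply/existsP; have := valP x; rewrite vertexE; apply: contraNT.
rewrite negb_exists => /forallP x0; apply/eqP/phi_inj => t.
by rewrite rmorph0; have := x0 t; rewrite negbK => /eqP.
Qed.

Lemma mk_vertex (c : forall t, K t) t : c t != 0 -> mk c \notin jacobson_radical R.
Proof.
by rewrite vertexE; apply: contraNneq => E; rewrite -mkE E rmorph0.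
Qed.

Definition vertex_of (c : forall t, K t) t (ct : c t != 0) : V :=
  Sub (mk c) (mk_vertex ct).

Lemma vcoord_vertex_of c t (ct : c t != 0) t' : vcoord (vertex_of ct) t' = c t'.
Proof. by rewrite /vcoord SubK mkE. Qed.

Lemma unit_coordE (r : R) : (r \is a GRing.unit) = [forall t, phi t r != 0].
Proof.
apply/idP/forallP=> [Ur t|r0].
  by rewrite -unitfE rmorph_unit.
apply/unitrP; exists (mk (fun t => (phi t r)^-1)).
by split; apply: phi_inj => t; rewrite rmorphM mkE rmorph1 ?mulVf ?divff ?r0.
Qed.

(* The adjacency of the Jacobson graph with a loop at every x with some
   x_t^2 = 1. *)
Definition meet x y := [exists t, vcoord x t * vcoord y t == 1].

Lemma meetP x y : reflect (exists t, vcoord x t * vcoord y t = 1) (meet x y).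
Proof. by apply: (iffP existsP) => [[t /eqP E]|[t E]]; exists t => //; apply/eqP. Qed.

Lemma meetC x y : meet x y = meet y x.
Proof. by apply: eq_existsb => t; rewrite mulrC. Qed.

Lemma adjE x y : jacobson_adj x y = (x != y) && meet x y.
Proof.
rewrite /jacobson_adj unit_coordE negb_forall; congr (_ && _).
by apply: eq_existsb => t; rewrite negbK rmorphB rmorph1 rmorphM subr_eq0 eq_sym.
Qed.

Lemma atom_coord_neq0 t (a : jacobson_vertex (K t)) :
  dfwith (fun t => 0 : K t) (val a) t != 0.
Proof. by rewrite dfwith_in field_vertex_neq0. Qed.

Definition atom t (a : jacobson_vertex (K t)) : V := vertex_of (atom_coord_neq0 a).

Lemma vcoord_atom t a : vcoord (@atom t a) t = val a.
Proof. by rewrite vcoord_vertex_of dfwith_in. Qed.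

Lemma vcoord_atom_out t a t' : t != t' -> vcoord (@atom t a) t' = 0.
Proof. by move=> tt'; rewrite vcoord_vertex_of dfwith_out. Qed.

Lemma meet_atom t a x : meet (@atom t a) x = (val a * vcoord x t == 1).
Proof.
apply/meetP/eqP=> [[t']|E]; last by exists t; rewrite vcoord_atom.
have [<-|tt'] := eqVneq t t'; first by rewrite vcoord_atom.
by rewrite vcoord_atom_out // mul0r => /eqP; rewrite eq_sym oner_eq0.
Qed.

Lemma atom_ex t (r : K t) : r != 0 -> exists a, vcoord (@atom t a) t = r.
Proof. by case/field_vertex_ex=> a <-; exists a; apply: vcoord_atom. Qed.

(** * Closed neighbourhoods and the preservation of loops *)

Definition cnbr x y := (x == y) || meet x y.

Lemma cnbrE x y : cnbr x y = (x == y) || jacobson_adj x y.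
Proof. by rewrite adjE /cnbr; case: eqP. Qed.

(** Unlike [meet], [cnbr] depends only on equality and adjacency, so its invariance does not
    presuppose that of loops. *)
Lemma cnbr_aut p x y : p \in jacobson_aut R -> cnbr (p x) (p y) = cnbr x y.
Proof. by move/graph_autP=> pA; rewrite !cnbrE pA (inj_eq perm_inj). Qed.

(* If p moves a looped x to a loopless y, let a <= x be a looped atom and
   b := p a.  The closed neighbourhood of a is a clique contained in that of x,
   so that of b is a clique contained in that of y; a loopless y allows
   neither b = y nor b != y unless there is only one coordinate. *)
Lemma aut_loop_sub p x : p \in jacobson_aut R -> meet x x -> meet (p x) (p x).
Proof.
move=> pA /meetP[t0 x2]; apply/contraT=> nly; set y := p x in nly.
have ny t : vcoord y t * vcoord y t != 1.
  by apply: contra nly => /eqP E; apply/meetP; exists t.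
have x0 : vcoord x t0 != 0.
  by apply: contra_eq_neq x2 => ->; rewrite mul0r eq_sym oner_eq0.
have [a aE] := atom_ex x0; rewrite vcoord_atom in aE.
have cnaP u : cnbr (atom a) u -> vcoord u t0 = vcoord x t0.
  case/orP=> [/eqP<-|]; first by rewrite vcoord_atom.
  by rewrite meet_atom aE -x2 (inj_eq (mulfI x0)) => /eqP.
have cna u v : cnbr (atom a) u -> cnbr (atom a) v -> cnbr u v.
  by move=> /cnaP Eu /cnaP Ev; apply/orP; right; apply/meetP; exists t0; rewrite Eu Ev.
have cnax u : cnbr (atom a) u -> cnbr x u.
  by move=> /cnaP Eu; apply/orP; right; apply/meetP; exists t0; rewrite Eu.
have pV u : u = p (p^-1 u)%g by rewrite permKV.
pose b := p (atom a).
have cnb u v : cnbr b u -> cnbr b v -> cnbr u v.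
  by rewrite /b [u]pV [v]pV !(cnbr_aut _ _ pA); apply: cna.
have cnby u : cnbr b u -> cnbr y u.
  by rewrite /b /y [u]pV !(cnbr_aut _ _ pA); apply: cnax.
have [[t1 single]|multi] :
    (exists t1 : T, forall t, t = t1) \/ (forall t, exists t', t != t').
  case: (pickP [pred t1 | [forall t : T, t == t1]]) => [t1 /forallP h|h].
    by left; exists t1 => t; apply/eqP.
  right=> t; have /negbT/= := h t; rewrite negb_forall => /existsP[t' ?].
  by exists t'; rewrite eq_sym.
  (* With one coordinate the looped [x] is isolated, whereas the loopless [y] is adjacent to its
     inverse. *)
  have T1 t t' : t = t' by rewrite (single t) (single t').
  have isol u : cnbr x u -> u = x.
    move=> cxu; apply: vcoord_inj => t; rewrite (T1 t t0); case/orP: cxu => [/eqP-> //|].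
    by case/meetP=> t'; rewrite (T1 t' t0) -x2 => /(mulfI x0).
  have [t y0] := vertex_coord_neq0 y.
  have yV0 : (vcoord y t)^-1 != 0 by rewrite invr_eq0.
  have [c cE] := atom_ex yV0.
  have cyc : cnbr y (atom c).
    by apply/orP; right; apply/meetP; exists t; rewrite cE divff.
  have Ey : atom c = y.
    by rewrite [LHS]pV [_ (atom c)]isol // -(cnbr_aut _ _ pA) -pV.
  by have := ny t; rewrite -{1}Ey cE mulVf ?eqxx.
(* If [b = y], the neighbourhood of [y] is a clique; but [atom c] and [d], both with [t]-coordinate
   the inverse of that of [y], differ at [t'] and do not meet. *)
have [bE|bNy] := eqVneq b y.
  have [t y0] := vertex_coord_neq0 y; have [t' tt'] := multi t.
  have yV0 : (vcoord y t)^-1 != 0 by rewrite invr_eq0.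
  have [c cE] := atom_ex yV0.
  pose d := dfwith (dfwith (fun t => 0 : K t) (1 : K t')) (vcoord y t)^-1.
  have d0 : d t != 0 by rewrite /d dfwith_in.
  have cyc : cnbr y (atom c).
    by apply/orP; right; apply/meetP; exists t; rewrite cE divff.
  have cyd : cnbr y (vertex_of d0).
    by apply/orP; right; apply/meetP; exists t; rewrite vcoord_vertex_of /d dfwith_in divff.
  rewrite -bE in cyc cyd; case/orP: (cnb _ _ cyc cyd) => [/eqP/(congr1 (vcoord^~ t'))|].
    rewrite vcoord_atom_out // vcoord_vertex_of /d dfwith_out // dfwith_in => /eqP.
    by rewrite eq_sym oner_eq0.
  rewrite meet_atom vcoord_vertex_of -(vcoord_atom c) cE /d dfwith_in -invfM invr_eq1.
  by move=> E; have := ny t; rewrite E.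
have /orP[/eqP E|/meetP[t ybt]] : cnbr y b by apply: cnby; rewrite /cnbr eqxx.
  by rewrite E eqxx in bNy.
have y0 : vcoord y t != 0.
  by apply: contra_eq_neq ybt => ->; rewrite mul0r eq_sym oner_eq0.
have [t' tt'] := multi t.
(* [r] is neither the [t']-coordinate of [y] nor inverse to it. So [d], which agrees with [y] at [t]
   and hence meets [b], is outside the closed neighbourhood of [y]. *)
pose r : K t' := if vcoord y t' == 0 then 1 else 0.
have rNy : r != vcoord y t'.
  by rewrite /r; case: (eqVneq (vcoord y t') 0) => [->|]; rewrite ?oner_eq0 // eq_sym.
have ryN : vcoord y t' * r != 1.
  rewrite /r; case: (eqVneq (vcoord y t') 0) => [->|_];
    by rewrite ?mul0r ?mulr0 eq_sym oner_eq0.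
pose d := dfwith (dfwith (fun t => 0 : K t) r) (vcoord y t).
have d0 : d t != 0 by rewrite /d dfwith_in.
have cbd : cnbr b (vertex_of d0).
  apply/orP; right; apply/meetP; exists t.
  by rewrite vcoord_vertex_of /d dfwith_in mulrC.
case/orP: (cnby _ cbd) => [/eqP/(congr1 (vcoord^~ t'))|/meetP[t'']].
  by rewrite vcoord_vertex_of /d dfwith_out // dfwith_in => E; rewrite E eqxx in rNy.
rewrite vcoord_vertex_of /d => /eqP; have [<-|tt''] := eqVneq t t''.
  by rewrite dfwith_in (negPf (ny t)).
rewrite dfwith_out //; have [<-|t't''] := eqVneq t' t''.
  by rewrite dfwith_in (negPf ryN).
by rewrite dfwith_out // mulr0 eq_sym oner_eq0.
Qed.

Lemma meet_aut p x y : p \in jacobson_aut R -> meet (p x) (p y) = meet x y.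
Proof.
move=> pA; have [<-|xy] := eqVneq x y.
  apply/idP/idP; last exact: aut_loop_sub.
  by move/(aut_loop_sub (groupVr pA)); rewrite permK.
by have /graph_autP/(_ x y) := pA; rewrite !adjE (inj_eq perm_inj) xy.
Qed.

(** * The order on vectors and its minimal elements *)

Definition subvec x y := [forall t, (vcoord x t == 0) || (vcoord x t == vcoord y t)].

Lemma subvecP x y :
  reflect (forall t, vcoord x t != 0 -> vcoord y t = vcoord x t) (subvec x y).
Proof.
apply: (iffP forallP) => xy t; last first.
  by case: eqVneq => //= /xy->; rewrite eqxx.
by move/negPf=> x0; have := xy t; rewrite x0 => /eqP.
Qed.

(** For the converse, test with the atom at [t] inverse to a nonzero coordinate of [x]: meeting [y]
    forces [y] to have that coordinate. *)
Lemma subvec_meet x y : reflect (forall z, meet x z -> meet y z) (subvec x y).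
Proof.
apply: (iffP (subvecP x y)) => [xy z /meetP[t E]|xy t x0].
  apply/meetP; exists t; rewrite xy //.
  by apply: contra_eq_neq E => ->; rewrite mul0r eq_sym oner_eq0.
have xV0 : (vcoord x t)^-1 != 0 by rewrite invr_eq0.
have [c] := atom_ex xV0; rewrite vcoord_atom => cE.
have := xy (atom c); rewrite !(meetC _ (atom c)) !meet_atom cE mulVf // eqxx.
by move=> /(_ isT)/eqP E; rewrite -[LHS](mulVKf x0) E mulr1.
Qed.

Lemma subvec_aut p x y : p \in jacobson_aut R -> subvec (p x) (p y) = subvec x y.
Proof.
move=> pA; apply/subvec_meet/subvec_meet=> xy z.
  by move: (xy (p z)); rewrite !meet_aut.
by move: (xy (p^-1 z)%g); rewrite -!(meet_aut _ (p^-1 z)%g pA) permKV.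
Qed.

Lemma subvec_atom t a x : subvec (@atom t a) x = (vcoord x t == val a).
Proof.
apply/subvecP/eqP=> [/(_ t)|E t']; first by rewrite vcoord_atom => ->; rewrite ?field_vertex_neq0.
have [<-|tt'] := eqVneq t t'; first by rewrite vcoord_atom.
by rewrite vcoord_atom_out // eqxx.
Qed.

Lemma subvec_atom_eq t a x : subvec x (@atom t a) -> x = atom a.
Proof.
move/subvecP=> xa; have xout t' : t != t' -> vcoord x t' = 0.
  move=> tt'; apply/eqP/contraT=> /[dup] x0 /xa.
  by rewrite vcoord_atom_out // => E; rewrite -E eqxx in x0.
apply: vcoord_inj => t'; have [<-|tt'] := eqVneq t t'; last by rewrite xout ?vcoord_atom_out.
have [t1 x0] := vertex_coord_neq0 x; have [E|tt1] := eqVneq t t1.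
  by subst t1; rewrite xa.
by rewrite xout ?eqxx in x0.
Qed.

Lemma subvec_ext x y :
  (forall t (a : jacobson_vertex (K t)), subvec (atom a) x = subvec (atom a) y) -> x = y.
Proof.
move=> xy; apply: vcoord_inj => t.
have [y0|] := eqVneq (vcoord y t) 0; last first.
  by case/field_vertex_ex=> a aE; have := xy t a; rewrite !subvec_atom aE eqxx => /eqP.
have [->//|/field_vertex_ex[a aE]] := eqVneq (vcoord x t) 0.
by have := xy t a; rewrite !subvec_atom aE eqxx => /esym/eqP.
Qed.

Lemma aut_fix_atoms p : p \in jacobson_aut R ->
  (forall t (a : jacobson_vertex (K t)), p (atom a) = atom a) -> p = 1%g.
Proof.
move=> pA pfix; apply/permP=> x; rewrite perm1; apply: subvec_ext => t a.
by rewrite -{1}pfix subvec_aut.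
Qed.

Lemma atom_inj t : injective (@atom t).
Proof.
by move=> a b /(congr1 (vcoord^~ t)); rewrite !vcoord_atom => /val_inj.
Qed.

(** * Automorphisms acting on atoms and coordinates *)

Lemma adj_atom t (a b : jacobson_vertex (K t)) :
  jacobson_adj (atom a) (atom b) = jacobson_adj a b.
Proof.
rewrite adjE field_adjE meet_atom vcoord_atom inv_vertex_eq (inj_eq (@atom_inj t)).
by [].
Qed.

(** Take an atom below [p (atom a)]; its preimage lies below [atom a], hence equals it by
    minimality. *)
Lemma aut_atom p t (a : jacobson_vertex (K t)) : p \in jacobson_aut R ->
  exists t' (a' : jacobson_vertex (K t')), p (atom a) = atom a'.
Proof.
move=> pA; have [t' pa0] := vertex_coord_neq0 (p (atom a)).
have [a' a'E] := field_vertex_ex pa0; exists t', a'.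
have : subvec (atom a') (p (atom a)) by rewrite subvec_atom a'E.
rewrite -{1}[atom a'](permKV p) subvec_aut // => /subvec_atom_eq <-.
by rewrite permKV.
Qed.

(* Otherwise (atom a') and (atom b') have a common upper bound, hence so do the
   atoms of a and b, which forces a = b. *)
Lemma aut_atom_block p t t1 t2 (a b : jacobson_vertex (K t))
    (a' : jacobson_vertex (K t1)) (b' : jacobson_vertex (K t2)) :
  p \in jacobson_aut R -> p (atom a) = atom a' -> p (atom b) = atom b' -> t1 = t2.
Proof.
move=> pA pa pb; apply/eqP/contraT=> t12.
pose d := dfwith (dfwith (fun t => 0 : K t) (val b')) (val a').
have d0 : d t1 != 0 by rewrite /d dfwith_in field_vertex_neq0.
have : subvec (atom a) (p^-1 (vertex_of d0))%g.
  rewrite -(subvec_aut _ _ pA) permKV pa subvec_atom vcoord_vertex_of.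
  by rewrite /d dfwith_in.
have : subvec (atom b) (p^-1 (vertex_of d0))%g.
  rewrite -(subvec_aut _ _ pA) permKV pb subvec_atom vcoord_vertex_of.
  by rewrite /d dfwith_out // dfwith_in.
rewrite !subvec_atom => /eqP-> /eqP/val_inj ab.
move: pb; rewrite ab pa => /(congr1 (vcoord^~ t1)).
rewrite vcoord_atom [RHS]vcoord_atom_out 1?eq_sym // => /eqP.
by rewrite (negPf (field_vertex_neq0 _)).
Qed.

Lemma aut_coord p : p \in jacobson_aut R ->
  exists s : T -> T, forall t (a : jacobson_vertex (K t)),
    exists a' : jacobson_vertex (K (s t)), p (atom a) = atom a'.
Proof.
(* The image of the atom of 1 defines [s t]; the other atoms over [t] follow it by
   [aut_atom_block]. *)
move=> pA; pose e t := one_vertex (K t).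
have /fin_all_exists[s sE] t :
    exists t', [exists a' : jacobson_vertex (K t'), p (atom (e t)) == atom a'].
  have [t' [a' E]] := aut_atom (e t) pA.
  by exists t'; apply/existsP; exists a'; apply/eqP.
exists s => t a; have [t' [a' E]] := aut_atom a pA.
have /existsP[b /eqP bE] := sE t.
by have st := aut_atom_block pA E bE; subst t'; exists a'.
Qed.

(** The coordinate map of the inverse of [p] is a left inverse of [s]. Atoms over [t] inject into
    those over [s t], and back, so the fields have equal size. *)
Lemma aut_coord_bij p : p \in jacobson_aut R ->
  exists s : T -> T, [/\ injective s, forall t, #|K t| = #|K (s t)|
    & forall t (a : jacobson_vertex (K t)),
        exists a' : jacobson_vertex (K (s t)), p (atom a) = atom a'].
Proof.
move=> pA; have [s sE] := aut_coord pA; have [s' sE'] := aut_coord (groupVr pA).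
have leV q r t : q \in jacobson_aut R -> (forall t (a : jacobson_vertex (K t)),
    exists a' : jacobson_vertex (K (r t)), q (atom a) = atom a') -> (#|K t| <= #|K (r t)|)%N.
  move=> qA rE; have /fin_all_exists[f fE] := rE t.
  have f_inj : injective f.
    by move=> a b E; apply/atom_inj/(perm_inj (s := q)); rewrite !fE E.
  rewrite -(prednK (ltnW (finNzRing_gt1 (K t)))) -(prednK (ltnW (finNzRing_gt1 (K (r t))))).
  by rewrite ltnS -!card_field_vertex; apply: leq_card f_inj.
have ss' : cancel s s'.
  move=> t; have [a aE] := sE t (one_vertex (K t)); have [b bE] := sE' _ a.
  have : atom b = atom (one_vertex (K t)) by rewrite -bE -aE permK.
  move=> /(congr1 (vcoord^~ t)); rewrite vcoord_atom.
  have [//|st] := eqVneq (s' (s t)) t; rewrite vcoord_atom_out // => /esym/eqP.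
  by rewrite (negPf (field_vertex_neq0 _)).
exists s; split=> //; first exact: can_inj ss'.
move=> t; apply/eqP; rewrite eqn_leq (leV p s) //=.
by have := leV _ _ (s t) (groupVr pA) sE'; rewrite ss'.
Qed.
End Coordinates.

(** * The wreath products acting on the Jacobson graph *)

Section FieldAction.
Local Open Scope ring_scope.
Variable E : finFieldType.
Implicit Types (g h : {perm jacobson_vertex E}) (y z : E).

(** A permutation of the nonzero elements is extended by fixing 0, because coordinates of a vertex
    may vanish. *)
Definition field_act g y : E := if insub y is Some v then val (g v) else y.

Lemma field_act_val g v : field_act g (val v) = val (g v).
Proof. by rewrite /field_act valK. Qed.

Lemma field_act0 g : field_act g 0 = 0.
Proof. by rewrite /field_act insubF // field_vertexE eqxx. Qed.

Variant zero_or_vertex : E -> Type :=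
  | Zero : zero_or_vertex 0
  | Vertex (v : jacobson_vertex E) : zero_or_vertex (val v).

Lemma zero_or_vertexP y : zero_or_vertex y.
Proof.
have [->|] := eqVneq y 0; first exact: Zero.
rewrite -field_vertexE => y0.
by have := Vertex (Sub y y0); rewrite SubK.
Qed.

Lemma field_act1 y : field_act 1 y = y.
Proof. by case: (zero_or_vertexP y) => [|v]; rewrite ?field_act0 // field_act_val perm1. Qed.

Lemma field_actM g h y : field_act (g * h)%g y = field_act h (field_act g y).
Proof.
by case: (zero_or_vertexP y) => [|v]; rewrite ?field_act0 // !field_act_val permM.
Qed.

Lemma field_act_mul1 g y z : g \in jacobson_aut E ->
  (field_act g y * field_act g z == 1) = (y * z == 1).
Proof.
rewrite jacobson_aut_fieldE => /perm_centraliserP gC.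
case: (zero_or_vertexP y) => [|v]; first by rewrite field_act0 !mul0r.
case: (zero_or_vertexP z) => [|w]; first by rewrite field_act0 !mulr0.
by rewrite !field_act_val -!inv_vertex_eq -gC (inj_eq perm_inj).
Qed.
End FieldAction.

(** * The isomorphism with the product of wreath products *)

Section Assembly.
Variables (R : finComUnitRingType) (k : nat) (F : 'I_k -> finFieldType) (m : 'I_k -> nat).
Hypothesis R_semisimple : semisimple R.
Hypothesis F_distinct : forall i j : 'I_k, i <> j -> ~ field_isomorphic (F i) (F j).

Let T := {i : 'I_k & 'I_(m i)}.
Local Notation pos := (Tagged (fun i => 'I_(m i))).
Let K (t : T) := F (tag t).
Variables (phi : forall t : T, {rmorphism R -> K t}) (mk : (forall t, K t) -> R).
Hypothesis mkE : forall c t, phi t (mk c) = c t.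
Hypothesis phi_inj : forall x y, (forall t, phi t x = phi t y) -> x = y.

Let W : finGroupType := {dffun forall i : 'I_k, wreath (subg_of (jacobson_aut (F i))) (m i)}.

(** Acting on all of [R] lets the group laws be checked coordinatewise before restricting to
    vertices. *)
Definition prod_wreath_fun (u : W) (r : R) : R :=
  mk (fun t => field_act (sgval ((u (tag t)).2 (tagged t)))
                         (phi (pos ((u (tag t)).1^-1 (tagged t))) r)).

Lemma phi_prod_wreath_fun (u : W) r i j :
  phi (pos j) (prod_wreath_fun u r) =
  field_act (sgval ((u i).2 j)) (phi (pos ((u i).1^-1 j)) r).
Proof. by rewrite /prod_wreath_fun mkE. Qed.

Lemma prod_wreath_funM u v r :
  prod_wreath_fun (u * v) r = prod_wreath_fun v (prod_wreath_fun u r).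
Proof.
apply: phi_inj => -[i j]; rewrite !phi_prod_wreath_fun -field_actM.
have -> : (u * v) i = u i * v i by apply: dffunM.
by rewrite /= !ffunE /= invMg permM.
Qed.

Lemma prod_wreath_fun1 r : prod_wreath_fun 1 r = r.
Proof.
apply: phi_inj => -[i j]; rewrite !phi_prod_wreath_fun.
have -> : (1 : W) i = 1 by rewrite ffunE.
by rewrite /= ffunE invg1 perm1 field_act1.
Qed.

Lemma prod_wreath_fun0 u : prod_wreath_fun u 0%R = 0%R.
Proof. by apply: phi_inj => -[i j]; rewrite phi_prod_wreath_fun !rmorph0 field_act0. Qed.

Lemma prod_wreath_funK u : cancel (prod_wreath_fun u) (prod_wreath_fun u^-1).
Proof. by move=> r; rewrite -prod_wreath_funM mulgV prod_wreath_fun1. Qed.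

Lemma prod_wreath_fun_vertex u (x : jacobson_vertex R) :
  prod_wreath_fun u (val x) \notin jacobson_radical R.
Proof.
have := valP x; rewrite !vertexE //; apply: contraNneq => E.
by rewrite -(prod_wreath_funK u (val x)) E prod_wreath_fun0.
Qed.

Definition prod_wreath_vertex u x : jacobson_vertex R :=
  Sub (prod_wreath_fun u (val x)) (prod_wreath_fun_vertex u x).

Lemma prod_wreath_vertex_inj u : injective (prod_wreath_vertex u).
Proof.
by move=> x y [/(can_inj (prod_wreath_funK u))/val_inj].
Qed.

Definition prod_wreath_perm u := perm (@prod_wreath_vertex_inj u).

Lemma vcoord_prod_wreath_perm u x i j :
  vcoord phi (prod_wreath_perm u x) (pos j) =
  field_act (sgval ((u i).2 j)) (vcoord phi x (pos ((u i).1^-1 j))).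
Proof. by rewrite permE /vcoord /= phi_prod_wreath_fun. Qed.

Lemma prod_wreath_permM : {in setT &, {morph prod_wreath_perm : u v / u * v}}.
Proof.
move=> u v _ _; apply/permP=> x; rewrite permM !permE; apply: val_inj.
exact: prod_wreath_funM.
Qed.
Canonical prod_wreath_perm_morphism := Morphism prod_wreath_permM.

Lemma prod_wreath_perm_aut u : prod_wreath_perm u \in jacobson_aut R.
Proof.
apply/graph_autP=> x y; rewrite !(adjE mkE phi_inj) (inj_eq perm_inj); congr (_ && _).
apply/meetP/meetP=> -[[i j] E].
  exists (pos ((u i).1^-1 j)); move/eqP: E; rewrite !vcoord_prod_wreath_perm.
  by rewrite field_act_mul1 ?subgP // => /eqP.
exists (pos ((u i).1 j)); apply/eqP; rewrite !vcoord_prod_wreath_perm permK.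
by rewrite field_act_mul1 ?subgP // E.
Qed.

Local Notation at_pos j a := (@atom R T K phi mk R_semisimple mkE (pos j) a).

Lemma at_pos_inj i (j j' : 'I_(m i)) (a a' : jacobson_vertex (F i)) :
  at_pos j a = at_pos j' a' -> j = j' /\ a = a'.
Proof.
have [<- /atom_inj->//|jj'] := eqVneq j j'.
move/(congr1 ((vcoord phi)^~ (pos j))); rewrite vcoord_atom vcoord_atom_out.
  by move/eqP; rewrite (negPf (field_vertex_neq0 _)).
by rewrite eq_Tagged eq_sym.
Qed.

Lemma prod_wreath_perm_atom u i (j : 'I_(m i)) (a : jacobson_vertex (F i)) :
  prod_wreath_perm u (at_pos j a) =
  at_pos ((u i).1 j) (sgval ((u i).2 ((u i).1 j)) a).
Proof.
apply: (vcoord_inj phi_inj) => t.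
have [<-|ne] := eqVneq (pos ((u i).1 j)) t.
  by rewrite vcoord_prod_wreath_perm permK !vcoord_atom field_act_val.
rewrite [RHS]vcoord_atom_out //; case: t ne => i' j' ne.
rewrite vcoord_prod_wreath_perm vcoord_atom_out ?field_act0 //.
apply: contraNneq ne => /(congr1 (fun t => pos ((u (tag t)).1 (tagged t)))) /= ->.
by rewrite permKV.
Qed.

Lemma injm_prod_wreath_perm : 'injm prod_wreath_perm.
Proof.
apply/subsetP=> u /morphpreP[_ /set1P u1]; apply/set1P/ffunP=> i; rewrite ffunE.
have uE j a : (u i).1 j = j /\ sgval ((u i).2 ((u i).1 j)) a = a.
  by have := prod_wreath_perm_atom u j a; rewrite u1 perm1 => /at_pos_inj[].
have u1j j : (u i).1 j = j by have [] := uE j (one_vertex (F i)).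
apply: wreath_eq => /=; first by apply/permP=> j; rewrite perm1 u1j.
apply/ffunP=> j; rewrite ffunE; apply/val_inj/permP=> a; rewrite perm1.
by have [_] := uE j a; rewrite u1j.
Qed.

Lemma prod_wreath_perm_onto p : p \in jacobson_aut R ->
  exists u, p = prod_wreath_perm u.
Proof.
move=> pA; have [s [s_inj cardK sE]] := aut_coord_bij R_semisimple mkE phi_inj pA.
(* Fields of equal size are isomorphic, so [s] only permutes copies of the same [F i]. *)
have tag_s t : tag (s t) = tag t.
  apply/eqP/contraT=> /eqP ne; case: (F_distinct ne).
  by apply: finField_card_isomorphic; rewrite -[RHS]/#|K t| cardK.
have /fin_all_exists[w wE] i : exists w : wreath (subg_of (jacobson_aut (F i))) (m i),
    forall j (a : jacobson_vertex (F i)),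
      p (at_pos j a) = at_pos (w.1 j) (sgval (w.2 (w.1 j)) a).
  have /fin_all_exists[r rE] (j : 'I_(m i)) : exists j' : 'I_(m i), s (pos j) = pos j'.
    by case: (s _) (tag_s (pos j)) => i' j' /= E; subst i'; exists j'.
  have r_inj : injective r.
    move=> j j' E; have /s_inj/eqP : s (pos j) = s (pos j') by rewrite !rE E.
    by rewrite eq_Tagged => /eqP.
  have /fin_all_exists[g gE] (j : 'I_(m i)) :
      exists g : jacobson_vertex (F i) -> jacobson_vertex (F i),
      forall a, p (at_pos j a) = at_pos (r j) (g a).
    have /fin_all_exists[h hE] a :
        exists a' : jacobson_vertex (F i), p (at_pos j a) = at_pos (r j) a'.
      by have := sE (pos j) a; rewrite rE.
    by exists h.
  have g_inj j : injective (g j).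
    move=> a b E; have /perm_inj/at_pos_inj[] // : p (at_pos j a) = p (at_pos j b).
    by rewrite !gE E.
  (* Atoms over one coordinate induce the Jacobson graph of its field. *)
  have gA j : perm (g_inj j) \in jacobson_aut (F i).
    apply/graph_autP=> a b; rewrite !permE.
    have := graph_autP _ _ pA (at_pos j a) (at_pos j b).
    by rewrite !gE !adj_atom.
  pose G : wreath_base (subg_of (jacobson_aut (F i))) (m i) :=
    [ffun j => subg (jacobson_aut (F i)) (perm (g_inj ((perm r_inj)^-1 j)))].
  have wP : (perm r_inj, G) \in setX [set: 'S_(m i)] [set: wreath_base _ (m i)].
    by rewrite !inE.
  exists (SdPair (coord_perm_groupAction _ (m i)) wP) => j a /=.
  by rewrite ffunE permK subgK // !permE gE.
pose u : W := [ffun i => w i]; exists u.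
(* The quotient of [p] by [prod_wreath_perm u] fixes every atom, hence is trivial. *)
apply/eqP; rewrite eq_mulgV1; apply/eqP.
apply: (aut_fix_atoms (R_semisimple := R_semisimple) (mkE := mkE) phi_inj).
  by rewrite groupM ?groupV ?prod_wreath_perm_aut.
move=> [i j] a; rewrite permM; apply: (canLR (permK _)).
by rewrite (prod_wreath_perm_atom u) ffunE wE.
Qed.

Lemma prod_wreath_isog : jacobson_aut R \isog [set: W].
Proof.
have im : prod_wreath_perm @* setT = jacobson_aut R.
  apply/setP=> p; apply/morphimP/idP=> [[u _ _ ->]|/prod_wreath_perm_onto[u ->]].
    exact: prod_wreath_perm_aut.
  by exists u; rewrite ?inE.
rewrite isog_sym -im; exact: sub_isog (subxx _) injm_prod_wreath_perm.
Qed.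

End Assembly.

(* Zp n is the cyclic group of order n, trivial for n = 1. *)
Theorem corollary3p4 (R : finComUnitRingType) (k : nat)
    (F : 'I_k -> finFieldType) (m : 'I_k -> nat)
    (R_semisimple : semisimple R)
    (F_distinct : forall i j : 'I_k, i <> j -> ~ field_isomorphic (F i) (F j))
    (m_gt0 : forall i : 'I_k, (1 <= m i)%N)
    (R_decomp : direct_sum_decomposition R F m) :
  [/\ jacobson_aut R
        \isog [set: {dffun forall i : 'I_k,
                       wreath (subg_of (jacobson_aut (F i))) (m i)}],
      forall i : 'I_k, (4 <= #|F i|)%N ->
        jacobson_aut (F i)
          \isog setX [set: wreath ('Z_2) ((#|F i| - 2 - parity (F i)) %/ 2)]
                     (Zp (parity (F i) + 1)),
      forall E : finFieldType, #|E| = 3 -> jacobson_aut E \isog Zp 2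
    & forall E : finFieldType, #|E| = 2 -> jacobson_aut E = 1 :> {set _}].
Proof.
split=> [|i _|E|E]; [|exact: jacobson_aut_field_isog|exact: jacobson_aut_card3
  |exact: jacobson_aut_card2].
have [phi [psi phiK psiK]] := R_decomp.
pose T := {i : 'I_k & 'I_(m i)}.
pose mk (c : forall t : T, F (tag t)) : R :=
  psi [ffun i => [ffun j => c (Tagged (fun i => 'I_(m i)) j)]].
apply: (@prod_wreath_isog R k F m R_semisimple F_distinct
          (fun t : T => phi (tag t) (tagged t)) mk) => [c [i j]|x y xy].
  have /ffunP/(_ i) := psiK [ffun i => [ffun j => c (Tagged (fun i => 'I_(m i)) j)]].
  by rewrite !ffunE => /ffunP/(_ j); rewrite !ffunE.
apply: (can_inj phiK); apply/ffunP=> i; rewrite !ffunE; apply/ffunP=> j.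
by rewrite !ffunE; apply: (xy (Tagged (fun i => 'I_(m i)) j)).
Qed.
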